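(* Let $n\ge 3$ be an integer and let $\mathcal{A}_n(a,c)$ be a compact hyperbolic antiprism in $\mathbb{H}^3$ with $2n$ vertices given by its edge lengths $a,c$. Let $A$ and $C$ be its (interior) dihedral angles along the edges of length $a$ (edges of the $n$-gonal faces) and along the edges of length $c$ (lateral edges), respectively. Then $$\cos A=\frac{-\sqrt{\cosh a-1}\,\left(1+\cosh a-2\cosh c\,\cos\frac{\pi}{n}\right)}{\sqrt{2\left(1+\cosh a-2\cosh^2 c\right)\left(\cos\frac{2\pi}{n}-\cosh a\right)}},$$ $$\cos C=\frac{\cosh c-\cosh a\,\cosh c+2\left(\cosh^2 c-1\right)\cos\frac{\pi}{n}}{1+\cosh a-2\cosh^2 c}.$$
   Context: $\mathbb{H}^3$ is hyperbolic $3$-space of constant curvature $-1$. An antiprism $\mathcal{A}_n$ is a (non-degenerate, i.e. $3$-dimensional) convex polyhedron with $2n$ vertices having two equal regular $n$-gons as its top and bottom faces and $2n$ equal triangles as its lateral faces. It has the symmetry group $S_{2n}$, the cyclic group generated by a mirror-rotational symmetry of order $2n$: the composition of the rotation by the angle $\pi/n$ about the axis passing through the centres of the top and bottom faces with the reflection in a plane perpendicular to this axis (which passes through the midpoints of the lateral edges). This group acts transitively on the vertices: the vertices are $V_1,\dots,V_{2n}$ (indices modulo $2n$), where the generator maps $V_i\mapsto V_{i+1}$; the odd-indexed vertices form the top $n$-gon, the even-indexed vertices form the bottom $n$-gon, and the lateral faces are the triangles $V_iV_{i+1}V_{i+2}$. ''Compact'' means that all vertices are (finite) points of $\mathbb{H}^3$.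 There are two types of edges: $a$ denotes the hyperbolic length of the edges of the top and bottom $n$-gonal faces (the edges $V_iV_{i+2}$), and $c$ denotes the hyperbolic length of the lateral edges (the edges $V_iV_{i+1}$). $\mathcal{A}_n(a,c)$ denotes the antiprism $\mathcal{A}_n$ given by its edge lengths $a,c$. *)

(* Defs.v *)
From mathcomp Require Import all_boot all_order all_algebra.
From mathcomp Require Import all_classical all_reals all_analysis.

Set Implicit Arguments.
Unset Strict Implicit.
Unset Printing Implicit Defensive.

Import Order.TTheory GRing.Theory Num.Theory.

Local Open Scope classical_set_scope.
Local Open Scope ring_scope.

(** Hyperbolic 3-space is the upper sheet of the hyperboloid in R^{3,1};
    coordinate 0 is the timelike one. *)

Definition mink (R : realType) (x y : 'rV[R]_4) : R :=
  - (x 0 0 * y 0 0) + \sum_(k < 3) x 0 (lift 0 k) * y 0 (lift 0 k).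

Definition H3 (R : realType) : set 'rV[R]_4 :=
  [set x | mink x x = -1 /\ 0 < x 0 0].

Definition cosh (R : realType) (x : R) : R := (expR x + expR (- x)) / 2.

Definition arcosh (R : realType) (t : R) : R := ln (t + Num.sqrt (t ^+ 2 - 1)).

Definition hdist (R : realType) (x y : 'rV[R]_4) : R := arcosh (- mink x y).

(** A hyperbolic plane is given by a unit spacelike vector [nu]; at each of its
    points [nu] is also the unit tangent vector of H^3 normal to the plane. *)
Definition hplane (R : realType) (nu : 'rV[R]_4) : set 'rV[R]_4 :=
  [set x | H3 x /\ mink x nu = 0].

(** The convex hull in H^3 of the points [V i], [i \in S]: in the hyperboloid
    model geodesic segments are the central projections of straight ones, so
    the hull is the intersection of H^3 with the convex cone over the points. *)
Definition hull (R : realType) (I : finType) (V : I -> 'rV[R]_4) (S : pred I) :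
    set 'rV[R]_4 :=
  [set x | H3 x /\ exists l : I -> R,
     (forall i, 0 <= l i) /\ x = \sum_(i | S i) l i *: V i].

(** [nu] is the unit normal, pointing out of [P], of the plane of the face [F]. *)
Definition outward_normal (R : realType) (P F : set 'rV[R]_4) (nu : 'rV[R]_4) :
    Prop :=
  [/\ mink nu nu = 1, (forall x, P x -> mink x nu <= 0) & F = P `&` hplane nu].

(** Two-dimensional faces: those not contained in a geodesic line. *)
Definition face (R : realType) (P F : set 'rV[R]_4) : Prop :=
  (exists nu, outward_normal P F nu) /\
  exists p q r, [/\ F p, F q, F r & row_free (col_mx p (col_mx q r))].

(** [theta] is the interior dihedral angle of the convex polyhedron [P] along
    its edge [E]: the supplement of the angle between the outward normals, at a
    point of [E], of the two faces that meet along [E]. *)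
Definition dihedral_angle (R : realType) (P E : set 'rV[R]_4) (theta : R) :
    Prop :=
  exists F1 F2 nu1 nu2,
    [/\ face P F1 /\ face P F2, F1 `&` F2 = E,
        outward_normal P F1 nu1, outward_normal P F2 nu2
      & theta = pi - acos (mink nu1 nu2)].

(** For Lorentz-orthonormal spacelike [u], [v]: the rotation of H^3 by [theta]
    about the geodesic line orthogonal to [u] and [v]. *)
Definition rotation (R : realType) (u v : 'rV[R]_4) (theta : R)
    (x : 'rV[R]_4) : 'rV[R]_4 :=
  x - mink x u *: u - mink x v *: v
    + mink x u *: (cos theta *: u + sin theta *: v)
    + mink x v *: (- sin theta *: u + cos theta *: v).

Definition reflection (R : realType) (w x : 'rV[R]_4) : 'rV[R]_4 :=
  x - (2 * mink x w) *: w.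

(** Since [w] is orthogonal to [u] and [v], it is tangent to the rotation axis
    where the axis meets [hplane w]: that plane is perpendicular to the axis. *)
Definition mirror_rotation (R : realType) (theta : R)
    (g : 'rV[R]_4 -> 'rV[R]_4) : Prop :=
  exists u v w : 'rV[R]_4,
    [/\ [/\ mink u u = 1, mink v v = 1 & mink w w = 1],
        [/\ mink u v = 0, mink u w = 0 & mink v w = 0]
      & forall x, g x = reflection w (rotation u v theta x)].

(** The vertices are indexed by residues modulo 2n, with successor [ordS].
    Regularity of the two n-gons, and the equality of the n-gons and of the
    triangles, are carried by the symmetry that permutes the vertices
    cyclically. *)
Record antiprism (R : realType) (n : nat) (V : 'I_n.*2 -> 'rV[R]_4) : Prop :=
  Antiprism {
    antiprism_compact : forall i, H3 (V i);
    antiprism_inj : injective V;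
    antiprism_sym : exists g, mirror_rotation (pi / n%:R) g /\
      forall i, g (V i) = V (ordS i);
    antiprism_nondegenerate : ~ exists nu : 'rV[R]_4,
      mink nu nu = 1 /\ hull V predT `<=` hplane nu;
    antiprism_faces : forall F, face (hull V predT) F <->
      [\/ F = hull V [pred k : 'I_n.*2 | odd k],
          F = hull V [pred k : 'I_n.*2 | ~~ odd k]
        | exists i, F = hull V (pred3 i (ordS i) (ordS (ordS i)))]
  }.

(* Main.v *)
Require Import Defs.
From mathcomp Require Import all_boot all_order all_algebra.
From mathcomp Require Import all_classical all_reals all_analysis.
From mathcomp Require Import ring lra zify.

Import Order.TTheory GRing.Theory Num.Theory.

Local Open Scope ring_scope.

(** The mirror rotation fixes the Minkowski component of a vector that is
    orthogonal to its three unit vectors, so all vertices share one timelike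
    component [q], their distance [r] to the axis is constant, and their height
    alternates between [h] and [- h].  Hence ([antiprism_has_frame])
    [V k = r u_k + (-1)^k h w + q], where the orthonormal pair [u_k], [v_k] turns
    by [pi / n] from one vertex to the next, and [mink q q = - Q] with
    [Q = 1 + r^2 + h^2].  In these terms, with [C = cos (pi / n)],
      [cosh a = 1 + 2 r^2 (1 - C^2)]  and  [cosh c = 1 + 2 h^2 + r^2 (1 - C)].

    The cosine of a dihedral angle is minus the product of the outward unit
    normals of the two faces at the edge ([cos_dihedral]).  To know which faces
    these are, note that a vertex lies in the hull of other vertices only if it
    is one of them ([hull_vertex]): distinct points of the hyperboloid have
    product less than -1, and all vertices are at the same height along [q].
    An edge of length [a] is therefore shared by an n-gon and a triangle, an edge
    of length [c] by two consecutive triangles ([faces_at_edge_a],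
    [faces_at_edge_c]).

    The frame vectors together with [q] form an orthogonal basis of the
    Minkowski space, so a normal is known from four coordinates
    ([mink_frame]).  The normal of an n-gon has no component along [u_k] and
    [v_k] ([ngon_normal]); the normal of a triangle has, in the frame at the
    middle vertex of the triangle, no component along [v_k], and the other
    components are explicit multiples of the one along [u_k], whose square is
    fixed by normalization and whose sign is fixed by the side on which the
    polyhedron lies ([triangle_normal]).  Multiplying out these coordinates and
    eliminating [r] and [h] gives the two formulas ([antiprism_cos_A],
    [antiprism_cos_C]). *)

(** * The Minkowski form *)

Lemma minkE {R : realType} (x y : 'rV[R]_4) :
  mink x y = - (x 0 0 * y 0 0) + x 0 (lift 0 0) * y 0 (lift 0 0)
    + x 0 (lift 0 (lift 0 0)) * y 0 (lift 0 (lift 0 0))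
    + x 0 (lift 0 (lift 0 (lift 0 0))) * y 0 (lift 0 (lift 0 (lift 0 0))).
Proof. by rewrite /mink !big_ord_recl big_ord0 addr0 !addrA. Qed.

Lemma minkC {R : realType} (x y : 'rV[R]_4) : mink x y = mink y x.
Proof. by rewrite !minkE; ring. Qed.

Lemma minkDl {R : realType} (x y z : 'rV[R]_4) :
  mink (x + y) z = mink x z + mink y z.
Proof. by rewrite !minkE !mxE; ring. Qed.

Lemma minkZl {R : realType} (t : R) (x y : 'rV[R]_4) :
  mink (t *: x) y = t * mink x y.
Proof. by rewrite !minkE !mxE; ring. Qed.

Lemma minkNl {R : realType} (x y : 'rV[R]_4) : mink (- x) y = - mink x y.
Proof. by rewrite !minkE !mxE; ring. Qed.

Lemma minkDr {R : realType} (x y z : 'rV[R]_4) :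
  mink z (x + y) = mink z x + mink z y.
Proof. by rewrite !(minkC z) minkDl. Qed.

Lemma minkZr {R : realType} (t : R) (x y : 'rV[R]_4) :
  mink y (t *: x) = t * mink y x.
Proof. by rewrite !(minkC y) minkZl. Qed.

Lemma minkNr {R : realType} (x y : 'rV[R]_4) : mink y (- x) = - mink y x.
Proof. by rewrite !(minkC y) minkNl. Qed.

Definition minkL {R : realType} :=
  (@minkDl R, @minkDr R, @minkNl R, @minkNr R, @minkZl R, @minkZr R).

Lemma mink_sumr {R : realType} (I : finType) (P : pred I) (l : I -> R)
    (V : I -> 'rV[R]_4) (y : 'rV[R]_4) :
  mink y (\sum_(i | P i) l i *: V i) = \sum_(i | P i) l i * mink y (V i).
Proof.
apply: (big_ind2 (fun a b => mink y a = b)) => [|a b c d <- <-|i _].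
- by rewrite minkE !mxE; ring.
- exact: minkDr.
- exact: minkZr.
Qed.

(** Four vectors with an invertible diagonal Gram matrix form a basis: with [M]
    the matrix of these vectors, [J] the matrix of the form and [D] the inverse
    of the Gram matrix, [M J M^T D = 1] commutes to [J M^T D M = 1], which can be
    inserted in the product of [x] and [y]. *)
Lemma mink_orthogonal_expansion {R : realType} (e : 'I_4 -> 'rV[R]_4)
    (d : 'I_4 -> R) (x y : 'rV[R]_4) :
    (forall i j, mink (e i) (e j) = d i *+ (i == j)) ->
    (forall i, d i != 0) ->
  mink x y = \sum_i mink x (e i) * mink y (e i) / d i.
Proof.
move=> gram d0.
pose J : 'M[R]_4 := diag_mx (\row_i (if i == 0 then -1 else 1)).
have minkJ (a b : 'rV[R]_4) : mink a b = (a *m J *m b^T) 0 0.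
  rewrite minkE mxE !big_ord_recl big_ord0 /J mul_mx_diag !mxE /=; ring.
pose M : 'M[R]_4 := \matrix_i e i.
pose D : 'M[R]_4 := diag_mx (\row_i (d i)^-1).
have rowM (a : 'rV[R]_4) i : (a *m J *m M^T) 0 i = mink a (e i).
  rewrite minkJ !mxE; apply: eq_bigr => k _; congr (_ * _).
  by rewrite !mxE.
have MJ : M *m (J *m M^T *m D) = 1%:M.
  rewrite !mulmxA; apply/matrixP => i j.
  rewrite mul_mx_diag !mxE.
  have -> : \sum_k (M *m J) i k * M^T k j = mink (e i) (e j).
    rewrite minkJ mxE; apply: eq_bigr => k _; congr (_ * _); last by rewrite !mxE.
    by rewrite !mxE; apply: eq_bigr => l _; rewrite !mxE.
  rewrite gram; have [->|_] := eqVneq i j; last by rewrite mulr0n mul0r.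
  by rewrite mulr1n divff.
have MJ' := mulmx1C MJ.
have -> : mink x y = ((x *m J *m M^T) *m D *m (M *m J *m y^T)) 0 0.
  rewrite minkJ; congr (_ 0 0).
  transitivity (x *m (J *m M^T *m D *m M) *m (J *m y^T)); last by rewrite !mulmxA.
  by rewrite MJ' mulmx1 mulmxA.
rewrite mxE; apply: eq_bigr => i _.
rewrite mul_mx_diag mxE rowM mxE.
have -> : (M *m J *m y^T) i 0 = mink y (e i).
  rewrite minkC minkJ !mxE; apply: eq_bigr => k _; congr (_ * _).
  by rewrite !mxE; apply: eq_bigr => l _; rewrite !mxE.
by rewrite mulrAC.
Qed.

Lemma mink_expansion {R : realType} {u v w q : 'rV[R]_4} {Q : R}
    (uvw : [/\ mink u u = 1, mink v v = 1 & mink w w = 1])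
    (uvw0 : [/\ mink u v = 0, mink u w = 0 & mink v w = 0])
    (q0 : [/\ mink u q = 0, mink v q = 0 & mink w q = 0])
    (qq : mink q q = - Q) (Q_gt0 : 0 < Q) (x y : 'rV[R]_4) :
  mink x y = mink x u * mink y u + mink x v * mink y v
    + mink x w * mink y w - mink x q * mink y q / Q.
Proof.
case: uvw uvw0 q0 => uu vv ww [uv uw vw] [uq vq wq].
rewrite (@mink_orthogonal_expansion _ (fun i => [:: u; v; w; q]`_i)
  (fun i => [:: 1; 1; 1; - Q]`_i)).
- by rewrite !big_ord_recl big_ord0 /= !divr1 invrN mulrN addr0 !addrA.
- by move=> [[|[|[|[|i]]]] ?] [[|[|[|[|j]]]] ?] //=;
    rewrite ?mulr0n ?mulr1n // minkC.
- by move=> [[|[|[|[|i]]]] ?] //=; rewrite ?oner_eq0 ?oppr_eq0 ?gt_eqF.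
Qed.

(** The tangent space of the hyperboloid at [p] is spacelike.  This is the
    Cauchy-Schwarz inequality for the spatial parts of [x] and [p], made explicit
    by the Lagrange identity. *)
Lemma mink_orth_ge0 {R : realType} {p x : 'rV[R]_4} :
  H3 p -> mink x p = 0 -> 0 <= mink x x.
Proof.
rewrite /H3 /= !minkE.
set e1 := lift 0 0; set e2 := lift 0 _; set e3 := lift 0 _.
move: (p 0 0) (p 0 e1) (p 0 e2) (p 0 e3) => p0 p1 p2 p3.
move: (x 0 0) (x 0 e1) (x 0 e2) (x 0 e3) => x0 x1 x2 x3 [pp p_gt0] xp.
have p2_gt0 : 0 < p0 ^+ 2 by rewrite exprn_gt0.
rewrite -(pmulr_rge0 _ p2_gt0).
have -> : p0 ^+ 2 * (- (x0 * x0) + x1 * x1 + x2 * x2 + x3 * x3) =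
  x1 ^+ 2 + x2 ^+ 2 + x3 ^+ 2 + (x1 * p2 - x2 * p1) ^+ 2
  + (x1 * p3 - x3 * p1) ^+ 2 + (x2 * p3 - x3 * p2) ^+ 2.
  have -> : p0 ^+ 2 * (- (x0 * x0) + x1 * x1 + x2 * x2 + x3 * x3) =
    p0 ^+ 2 * (x1 * x1 + x2 * x2 + x3 * x3) - (x0 * p0) ^+ 2 by ring.
  have -> : x0 * p0 = x1 * p1 + x2 * p2 + x3 * p3 by lra.
  have -> : p0 ^+ 2 = 1 + p1 ^+ 2 + p2 ^+ 2 + p3 ^+ 2 by lra.
  ring.
by rewrite !addr_ge0 ?sqr_ge0.
Qed.

(** The reversed Cauchy-Schwarz inequality, strict for distinct points.  By the
    Lagrange identity, the square of the product of the timelike coordinates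
    exceeds that of one plus the spatial product by a sum of squares which
    contains the squared differences of all spatial coordinates. *)
Lemma mink_H3_lt {R : realType} {x y : 'rV[R]_4} :
  H3 x -> H3 y -> x != y -> mink x y < -1.
Proof.
move=> [xx x_gt0] [yy y_gt0] /eqP neq.
rewrite ltNge; apply/negP => xy; apply: neq; move: xx yy xy.
rewrite !minkE => xx yy xy.
suff [e1 e2 e3] : [/\ x 0 (lift 0 0) = y 0 (lift 0 0),
    x 0 (lift 0 (lift 0 0)) = y 0 (lift 0 (lift 0 0))
  & x 0 (lift 0 (lift 0 (lift 0 0))) = y 0 (lift 0 (lift 0 (lift 0 0)))].
  have e0 : x 0 0 = y 0 0.
    apply/eqP; rewrite -(@eqrXn2 _ 2) ?ltW //; apply/eqP.
    by move: xx yy; rewrite e1 e2 e3; lra.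
  apply/rowP => -[[|[|[|[|//]]]] ?].
  - by rewrite (_ : Ordinal _ = 0) //; apply/val_inj.
  - by rewrite (_ : Ordinal _ = lift 0 0) //; apply/val_inj.
  - by rewrite (_ : Ordinal _ = lift 0 (lift 0 0)) //; apply/val_inj.
  - by rewrite (_ : Ordinal _ = lift 0 (lift 0 (lift 0 0))) //; apply/val_inj.
move: x_gt0 y_gt0 xx yy xy.
set i1 := lift 0 0; set i2 := lift 0 _; set i3 := lift 0 _.
move: (x 0 0) (x 0 i1) (x 0 i2) (x 0 i3) => x0 x1 x2 x3.
move: (y 0 0) (y 0 i1) (y 0 i2) (y 0 i3) => y0 y1 y2 y3 x_gt0 y_gt0 xx yy xy.
have le : (x0 * y0) ^+ 2 <= (1 + x1 * y1 + x2 * y2 + x3 * y3) ^+ 2.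
  have := mulr_gt0 x_gt0 y_gt0 => xy_gt0.
  rewrite lerXn2r ?nnegrE; lra.
have E : (x0 * y0) ^+ 2 - (1 + x1 * y1 + x2 * y2 + x3 * y3) ^+ 2 =
  (x1 - y1) ^+ 2 + (x2 - y2) ^+ 2 + (x3 - y3) ^+ 2 + (x1 * y2 - x2 * y1) ^+ 2
  + (x1 * y3 - x3 * y1) ^+ 2 + (x2 * y3 - x3 * y2) ^+ 2.
  rewrite exprMn.
  have -> : x0 ^+ 2 = 1 + x1 ^+ 2 + x2 ^+ 2 + x3 ^+ 2 by lra.
  have -> : y0 ^+ 2 = 1 + y1 ^+ 2 + y2 ^+ 2 + y3 ^+ 2 by lra.
  ring.
have := sqr_ge0 (x1 * y2 - x2 * y1); have := sqr_ge0 (x1 * y3 - x3 * y1).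
have := sqr_ge0 (x2 * y3 - x3 * y2).
have := sqr_ge0 (x1 - y1); have := sqr_ge0 (x2 - y2); have := sqr_ge0 (x3 - y3).
move=> s3 s2 s1 t1 t2 t3.
by split; apply/eqP; rewrite -subr_eq0 -sqrf_eq0; apply/eqP; lra.
Qed.

Lemma cosh_arcosh {R : realType} (t : R) : 1 <= t -> cosh (arcosh t) = t.
Proof.
move=> t_ge1; rewrite /cosh /arcosh expRN.
have sq_ge0 : 0 <= t ^+ 2 - 1 by rewrite subr_ge0 exprn_ege1.
set s := Num.sqrt _; have s_ge0 : 0 <= s by exact: sqrtr_ge0.
have ss : s ^+ 2 = t ^+ 2 - 1 by rewrite sqr_sqrtr.
have ts_gt0 : 0 < t + s by lra.
rewrite lnK ?posrE //.
have -> : (t + s)^-1 = t - s.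
  apply: (mulfI (lt0r_neq0 ts_gt0)); rewrite divff ?lt0r_neq0 //; lra.
lra.
Qed.

Lemma cosh_hdist {R : realType} {x y : 'rV[R]_4} :
  H3 x -> H3 y -> cosh (hdist x y) = - mink x y.
Proof.
move=> x_H3 y_H3; rewrite /hdist cosh_arcosh // lerNr.
have [<-|neq] := eqVneq x y; first by case: x_H3 => ->.
exact/ltW/mink_H3_lt.
Qed.

(** * The cyclic order of the indices *)

Lemma val_iter_ordS {N : nat} (m : nat) (k : 'I_N) :
  iter m (@ordS N) k = ((k + m) %% N)%N :> nat.
Proof.
elim: m => [|m IH]; first by rewrite addn0 modn_small.
by rewrite iterS /= IH -addn1 modnDml addn1 addnS.
Qed.

Lemma iter_ordS_fixed {N m : nat} {k : 'I_N} :
  iter m (@ordS N) k = k -> ~~ (0 < m < N)%N.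
Proof.
move=> /(congr1 val) /=; rewrite val_iter_ordS.
have kN := ltn_ord k; have [lt|ge] := ltnP (k + m) N.
  by rewrite modn_small //; lia.
have [mN|] := ltnP m N; last by lia.
by rewrite -(subnK ge) modnDr modn_small; lia.
Qed.

(** The successor acts transitively on the residues: [k] is reached from [l]
    after [N + k - l] steps, a form in which the truncated subtraction is
    harmless. *)
Lemma ordS_invariant {N : nat} {T : Type} (f : 'I_N -> T) :
  (forall k, f (ordS k) = f k) -> forall k l, f k = f l.
Proof.
move=> fS k l; have -> : k = iter (N + k - l) (@ordS N) l.
  apply: val_inj; rewrite /= val_iter_ordS.
  have [kN lN] := (ltn_ord k, ltn_ord l).
  by rewrite (_ : (l + _ = k + N)%N) ?modnDr ?modn_small //; lia.
by elim: (N + k - l)%N => // m IH; rewrite iterS fS.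
Qed.

Lemma odd_ordS {n : nat} (k : 'I_n.*2) : odd (ordS k) = ~~ odd k.
Proof. by rewrite /= odd_mod ?odd_double. Qed.

Lemma sign_ordS {R : realType} {n : nat} (k : 'I_n.*2) :
  (-1) ^+ ordS k = - (-1) ^+ k :> R.
Proof. by rewrite -signr_odd odd_ordS signrN signr_odd. Qed.

(** * Cylindrical coordinates for the vertices *)

(** Cylindrical coordinates adapted to the mirror rotation: [u k] and [v k] are
    the radial and the tangential direction at the vertex [k], [w] is the
    direction of the axis, and [q] is the timelike component common to all
    vertices. *)
Record antiprism_frame {R : realType} {n : nat} (V : 'I_n.*2 -> 'rV[R]_4)
    (u v : 'I_n.*2 -> 'rV[R]_4) (w q : 'rV[R]_4) (r h : R) : Prop :=
  AntiprismFrame {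
    frame_unit : forall k,
      [/\ mink (u k) (u k) = 1, mink (v k) (v k) = 1 & mink w w = 1];
    frame_orth : forall k,
      [/\ mink (u k) (v k) = 0, mink (u k) w = 0 & mink (v k) w = 0];
    frame_orth_q : forall k,
      [/\ mink (u k) q = 0, mink (v k) q = 0 & mink w q = 0];
    frame_q : mink q q = - (1 + r ^+ 2 + h ^+ 2);
    frame_vertex : forall k, V k = r *: u k + ((-1) ^+ k * h) *: w + q;
    frame_uS : forall k,
      u (ordS k) = cos (pi / n%:R) *: u k + sin (pi / n%:R) *: v k;
    frame_vS : forall k,
      v (ordS k) = - sin (pi / n%:R) *: u k + cos (pi / n%:R) *: v k;
    frame_r : 0 < r;
    frame_h : h != 0
  }.

Arguments frame_unit {R n V u v w q r h} _ _.
Arguments frame_orth {R n V u v w q r h} _ _.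
Arguments frame_orth_q {R n V u v w q r h} _ _.
Arguments frame_q {R n V u v w q r h} _.
Arguments frame_vertex {R n V u v w q r h} _ _.
Arguments frame_uS {R n V u v w q r h} _ _.
Arguments frame_vS {R n V u v w q r h} _ _.
Arguments frame_r {R n V u v w q r h} _.
Arguments frame_h {R n V u v w q r h} _.

(** The quantities [x^2 + y^2], [(-1)^k z] and the component orthogonal to the
    three axes are preserved by the symmetry, hence constant along the single
    orbit of vertices.  If [r] vanished, [V k] and [V (k + 2)] would coincide; if
    [h] vanished, all vertices would lie in the plane orthogonal to [w]. *)
Lemma antiprism_has_frame {R : realType} {n : nat} {V : 'I_n.*2 -> 'rV[R]_4} :
    (3 <= n)%N -> antiprism V ->
  exists u v w q r h, antiprism_frame V u v w q r h.
Proof.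
move=> n_ge3 [V_H3 V_inj [g [[u [v [w [[uu vv ww] [uv uw vw] gE]]]] gV]] nondeg _].
have i0 : 'I_n.*2 by exists 0%N; lia.
pose C : R := cos (pi / n%:R); pose S : R := sin (pi / n%:R).
have CS : C ^+ 2 + S ^+ 2 = 1 by exact: cos2Dsin2.
pose x k := mink (V k) u; pose y k := mink (V k) v; pose z k := mink (V k) w.
pose rest k := V k - x k *: u - y k *: v - z k *: w.
have [vu wu wv] : [/\ mink v u = 0, mink w u = 0 & mink w v = 0].
  by rewrite minkC uv minkC uw minkC vw.
have gm p : [/\ mink (g p) u = C * mink p u - S * mink p v,
    mink (g p) v = S * mink p u + C * mink p v & mink (g p) w = - mink p w].
  rewrite gE /reflection /rotation -/C -/S.
  by split; rewrite !minkL ?uu ?vv ?ww ?uv ?uw ?vw ?vu ?wu ?wv; ring.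
have xS k : x (ordS k) = C * x k - S * y k by rewrite /x -gV; case: (gm (V k)).
have yS k : y (ordS k) = S * x k + C * y k by rewrite /y -gV; case: (gm (V k)).
have zS k : z (ordS k) = - z k by rewrite /z -gV; case: (gm (V k)).
have restS k : rest (ordS k) = rest k.
  rewrite /rest xS yS zS -gV gE /reflection.
  have -> : mink (rotation u v (pi / n%:R) (V k)) w = z k.
    rewrite /rotation -/C -/S !minkL uw vw /z; ring.
  rewrite /rotation -/C -/S -/(x k) -/(y k).
  apply/rowP => l; rewrite !mxE; ring.
pose q := rest i0; pose r := Num.sqrt (x i0 ^+ 2 + y i0 ^+ 2).
pose h := (-1) ^+ i0 * z i0.
have restE k : rest k = q by exact: ordS_invariant.
have rr k : x k ^+ 2 + y k ^+ 2 = r ^+ 2.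
  rewrite /r sqr_sqrtr ?addr_ge0 ?sqr_ge0 //.
  apply: (@ordS_invariant _ _ (fun k : 'I_n.*2 => x k ^+ 2 + y k ^+ 2)) => l.
  rewrite xS yS -[RHS]mul1r -CS; ring.
have hE (k : 'I_n.*2) : h = (-1) ^+ k * z k.
  apply: (@ordS_invariant _ _ (fun k : 'I_n.*2 => (-1) ^+ k * z k)) => l.
  by rewrite sign_ordS zS mulrNN.
have zE (k : 'I_n.*2) : z k = (-1) ^+ k * h.
  by rewrite (hE k) mulrA -expr2 sqrr_sign mul1r.
have VE k : V k = x k *: u + y k *: v + z k *: w + q.
  by rewrite -(restE k) /rest; apply/rowP => l; rewrite !mxE; ring.
have qorth : [/\ mink u q = 0, mink v q = 0 & mink w q = 0].
  by split; rewrite /q /rest !minkL ?uu ?vv ?ww ?uv ?uw ?vw ?vu ?wu ?wv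
    [mink _ (V _)]minkC -/(x _) -/(y _) -/(z _); ring.
case: (qorth) => uq vq wq; clearbody q.
have r_gt0 : 0 < r.
  rewrite lt_neqAle sqrtr_ge0 andbT; apply/eqP => r0.
  have xy0 k : x k = 0 /\ y k = 0.
    have := rr k; rewrite -r0 => /eqP.
    by rewrite expr0n /= paddr_eq0 ?sqr_ge0 // !sqrf_eq0 => /andP[/eqP -> /eqP].
  have : V (ordS (ordS i0)) = V i0.
    rewrite !VE !zS opprK.
    by have [-> ->] := xy0 i0; have [-> ->] := xy0 (ordS (ordS i0)).
  by move/V_inj/(@iter_ordS_fixed _ 2 i0); lia.
have r_neq0 := lt0r_neq0 r_gt0.
have h_neq0 : h != 0.
  apply/eqP => h0; apply: nondeg; exists w; split=> // p [pH [l [_ pE]]].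
  split=> //; rewrite pE minkC mink_sumr big1 // => k _.
  by rewrite minkC -/(z k) zE h0 mulr0 mulr0.
(* The radial direction is the projection of the vertex to the plane of [u] and
   [v], normalized; the tangential one is its quarter turn. *)
exists (fun k => r^-1 *: (x k *: u + y k *: v)),
  (fun k => r^-1 *: (- y k *: u + x k *: v)), w, q, r, h.
split=> //.
- move=> k; have E := rr k.
  by split=> //; rewrite !minkL uu vv uv vu;
    apply: (mulfI (expf_neq0 2 r_neq0)); rewrite -[in RHS]E; field.
- by move=> k; split; rewrite !minkL ?uu ?vv ?uv ?vu ?uw ?vw; ring.
- by move=> k; split; rewrite // !minkL uq vq; ring.
- have [+ _] := V_H3 i0; rewrite VE !minkL uu vv ww uv uw vw vu wu wv uq vq wq.
  rewrite ![mink q _]minkC uq vq wq -(rr i0) (hE i0) exprMn sqrr_sign; lra.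
- by move=> k; rewrite scalerA divff // scale1r -zE.
- move=> k; rewrite xS yS; apply/rowP => l; rewrite !mxE -/C -/S; ring.
- move=> k; rewrite xS yS; apply/rowP => l; rewrite !mxE -/C -/S; ring.
Qed.

(** * The faces that meet along an edge *)

Lemma hull_gen {R : realType} {I : finType} {V : I -> 'rV[R]_4} {S : pred I}
    {k : I} : H3 (V k) -> S k -> hull V S (V k).
Proof.
move=> Vk Sk; split=> //; exists (fun l => (l == k)%:R); split=> [l|].
  exact: ler0n.
rewrite (bigD1 k) //= eqxx scale1r big1 ?addr0 // => l /andP[_ /negPf ->].
by rewrite scale0r.
Qed.

Lemma outward_normal_hull {R : realType} {I : finType} {V : I -> 'rV[R]_4}
    {S : pred I} {nu : 'rV[R]_4} :
    (forall k, H3 (V k)) -> outward_normal (hull V predT) (hull V S) nu ->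
  [/\ mink nu nu = 1, forall k, mink (V k) nu <= 0
    & forall k, S k -> mink (V k) nu = 0].
Proof.
move=> V_H3 [nu1 le0 SE]; split=> // k; first exact/le0/hull_gen.
move=> Sk; have : hull V S (V k) by exact: hull_gen.
by rewrite SE => -[_ []].
Qed.

Lemma mink_frame {R : realType} {n : nat} {V u v : 'I_n.*2 -> 'rV[R]_4}
    {w q : 'rV[R]_4} {r h : R} (F : antiprism_frame V u v w q r h) k x y :
  mink x y = mink x (u k) * mink y (u k) + mink x (v k) * mink y (v k)
    + mink x w * mink y w - mink x q * mink y q / (1 + r ^+ 2 + h ^+ 2).
Proof.
apply: (mink_expansion (frame_unit F k)
  (frame_orth F k) (frame_orth_q F k)
  (frame_q F)).
by have := sqr_ge0 r; have := sqr_ge0 h; lra.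
Qed.

Lemma mink_frame_vertex {R : realType} {n : nat} {V u v : 'I_n.*2 -> 'rV[R]_4}
    {w q : 'rV[R]_4} {r h : R} (F : antiprism_frame V u v w q r h) k x :
  mink (V k) x = r * mink x (u k) + (-1) ^+ k * h * mink x w + mink x q.
Proof. by rewrite (frame_vertex F) !minkL !(minkC x). Qed.

(** Multiplying [V k = sum l_i V_i] by [q] shows that the weights add up to 1,
    since all vertices have the same product with [q].  Multiplying by [V k] then
    gives -1 as a convex combination of the products of [V k] with the [V i].
    If [k] is not among the generators, each of these is less than -1. *)
Lemma hull_vertex {R : realType} {n : nat} {V : 'I_n.*2 -> 'rV[R]_4}
    {S : pred 'I_n.*2} {k : 'I_n.*2} :
  (3 <= n)%N -> antiprism V -> hull V S (V k) -> S k.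
Proof.
move=> n_ge3 AV; have [u [v [w [q [r [h F]]]]]] := antiprism_has_frame n_ge3 AV.
case: AV => V_H3 V_inj _ _ _ [_ [l [l_ge0 VkE]]].
have Q_neq0 : 1 + r ^+ 2 + h ^+ 2 != 0.
  by apply: lt0r_neq0; have := sqr_ge0 r; have := sqr_ge0 h; lra.
have Vq i : mink q (V i) = - (1 + r ^+ 2 + h ^+ 2).
  have [uq _ wq] := frame_orth_q F i.
  rewrite minkC (mink_frame_vertex F) ![mink q _]minkC uq wq.
  by rewrite (frame_q F); ring.
have l1 : \sum_(i | S i) l i = 1.
  have := congr1 (mink q) VkE; rewrite mink_sumr Vq.
  under eq_bigr do rewrite Vq.
  rewrite -mulr_suml -[LHS]mul1r => /mulIf -> //; by rewrite oppr_eq0.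
apply: contraT => NSk.
have [VkVk _] := V_H3 k.
have lt i : S i -> 0 < - (1 + mink (V k) (V i)).
  move=> Si; have : mink (V k) (V i) < -1; last by lra.
  apply: mink_H3_lt => //; apply: contraNneq NSk => /V_inj -> //.
have sum0 : \sum_(i | S i) l i * - (1 + mink (V k) (V i)) = 0.
  under eq_bigr do rewrite mulrN mulrDr mulr1.
  by rewrite sumrN big_split /= l1 -mink_sumr -VkE VkVk subrr oppr0.
have l0 i : S i -> l i = 0.
  move=> Si; have /eqP := psumr_eq0P
    (fun j Sj => mulr_ge0 (l_ge0 j) (ltW (lt j Sj))) sum0 Si.
  by rewrite mulf_eq0 (gt_eqF (lt i Si)) orbF => /eqP.
by move: l1; rewrite big1 // => /eqP; rewrite eq_sym oner_eq0.
Qed.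

Definition parity_class {n : nat} (b : bool) : pred 'I_n.*2 :=
  [pred k : 'I_n.*2 | odd k == b].
Definition triple {n : nat} (i : 'I_n.*2) : pred 'I_n.*2 :=
  pred3 i (ordS i) (ordS (ordS i)).

Lemma antiprism_faceE {R : realType} {n : nat} {V : 'I_n.*2 -> 'rV[R]_4}
    {F : set 'rV[R]_4} : antiprism V -> face (hull V predT) F ->
  (exists b, F = hull V (parity_class b)) \/ exists i, F = hull V (triple i).
Proof.
move=> AV /(antiprism_faces AV) [->|->|]; [left|left|by right].
  by exists true; congr hull; apply/funext => k; rewrite /parity_class /= eqb_id.
by exists false; congr hull; apply/funext => k; rewrite /parity_class /= eqbF_neg.
Qed.

Lemma triple_edge_a {n : nat} {i j : 'I_n.*2} : (3 <= n)%N ->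
  triple j i -> triple j (ordS (ordS i)) -> j = i.
Proof.
move=> n_ge3 /or3P[]/eqP-> /or3P[]/eqP //.
- by move/(@iter_ordS_fixed _ 3 j); lia.
- by move/ordS_inj/(@iter_ordS_fixed _ 2 j); lia.
- by move/ordS_inj/ordS_inj/(@iter_ordS_fixed _ 1 j); lia.
- by move/(@iter_ordS_fixed _ 4 j); lia.
- by move/ordS_inj/(@iter_ordS_fixed _ 3 j); lia.
- by move/ordS_inj/ordS_inj/(@iter_ordS_fixed _ 2 j); lia.
Qed.

Lemma triple_edge_c {n : nat} {i j : 'I_n.*2} : (3 <= n)%N ->
  triple j i -> triple j (ordS i) -> j = i \/ ordS j = i.
Proof.
move=> n_ge3 /or3P[]/eqP-> /or3P[]/eqP //; try by [left|right].
- by move/(@iter_ordS_fixed _ 3 j); lia.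
- by move/ordS_inj/(@iter_ordS_fixed _ 2 j); lia.
- by move/ordS_inj/ordS_inj/(@iter_ordS_fixed _ 1 j); lia.
Qed.

(** A face through both ends of the edge is generated by a set of vertices that
    contains them, which leaves the n-gon and one triangle.  The two faces at the
    edge differ, because each candidate has a vertex besides the ends of the
    edge; for the n-gon this vertex is [i + 4], distinct from [i] as [n >= 3]. *)
Lemma faces_at_edge_a {R : realType} {n : nat} {V : 'I_n.*2 -> 'rV[R]_4}
    {i : 'I_n.*2} {F1 F2 : set 'rV[R]_4} :
    (3 <= n)%N -> antiprism V ->
    face (hull V predT) F1 -> face (hull V predT) F2 ->
    (F1 `&` F2)%classic = hull V (pred2 i (ordS (ordS i))) ->
  (F1 = hull V (parity_class (odd i)) /\ F2 = hull V (triple i)) \/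
  (F2 = hull V (parity_class (odd i)) /\ F1 = hull V (triple i)).
Proof.
move=> n_ge3 AV F1_face F2_face F12.
have V_H3 := antiprism_compact AV.
have gens : (F1 `&` F2)%classic (V i) /\ (F1 `&` F2)%classic (V (ordS (ordS i))).
  by rewrite F12; split; apply: hull_gen => //=; rewrite eqxx ?orbT.
have candidates G : face (hull V predT) G -> G (V i) -> G (V (ordS (ordS i))) ->
    G = hull V (parity_class (odd i)) \/ G = hull V (triple i).
  move=> /(antiprism_faceE AV) [[b ->]|[j ->]] /(hull_vertex n_ge3 AV) ini
    /(hull_vertex n_ge3 AV) inSSi; [left|right].
  - by move: ini => /eqP ->.
  - by rewrite (triple_edge_a n_ge3 ini inSSi).
case: gens => -[in1 in2] [in1' in2'].
have not_edge (S : pred 'I_n.*2) k : F1 = hull V S -> F2 = hull V S -> S k ->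
    k = i \/ k = ordS (ordS i).
  move=> E1 E2 Sk; have : hull V S (V k) by exact: hull_gen.
  move: F12; rewrite E1 E2 setIid => -> /(hull_vertex n_ge3 AV) /pred2P.
  by [].
case: (candidates F1 F1_face in1 in1') => E1;
  case: (candidates F2 F2_face in2 in2') => E2; [exfalso|by left|by right|exfalso].
- case: (not_edge _ (ordS (ordS (ordS (ordS i)))) E1 E2).
  + by apply/eqP; rewrite !odd_ordS !negbK.
  + by move/(@iter_ordS_fixed _ 4 i); lia.
  + by move/ordS_inj/ordS_inj/(@iter_ordS_fixed _ 2 i); lia.
- case: (not_edge _ (ordS i) E1 E2).
  + by rewrite /triple /= eqxx orbT.
  + by move/(@iter_ordS_fixed _ 1 i); lia.
  + by move/ordS_inj/esym/(@iter_ordS_fixed _ 1 i); lia.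
Qed.

Lemma faces_at_edge_c {R : realType} {n : nat} {V : 'I_n.*2 -> 'rV[R]_4}
    {j : 'I_n.*2} {F1 F2 : set 'rV[R]_4} :
    (3 <= n)%N -> antiprism V ->
    face (hull V predT) F1 -> face (hull V predT) F2 ->
    (F1 `&` F2)%classic = hull V (pred2 j (ordS j)) ->
  exists2 i, ordS i = j &
  (F1 = hull V (triple i) /\ F2 = hull V (triple j)) \/
  (F2 = hull V (triple i) /\ F1 = hull V (triple j)).
Proof.
move=> n_ge3 AV F1_face F2_face F12; exists (ord_pred j); first exact: ord_predK.
have := ord_predK j; move: (ord_pred j) => i ij; move: F12; rewrite -{j}ij => F12.
have V_H3 := antiprism_compact AV.
have gens : (F1 `&` F2)%classic (V (ordS i)) /\ (F1 `&` F2)%classic (V (ordS (ordS i))).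
  by rewrite F12; split; apply: hull_gen => //=; rewrite eqxx ?orbT.
have candidates G : face (hull V predT) G ->
    G (V (ordS i)) -> G (V (ordS (ordS i))) ->
    G = hull V (triple i) \/ G = hull V (triple (ordS i)).
  move=> /(antiprism_faceE AV) [[b ->]|[k ->]] /(hull_vertex n_ge3 AV) in1
    /(hull_vertex n_ge3 AV) in2.
  - by move: in2 => /eqP; rewrite odd_ordS (eqP in1); case: b {in1}.
  - case: (triple_edge_c n_ge3 in1 in2) => [->|/ordS_inj ->]; by [left|right].
case: gens => -[in1 in2] [in1' in2'].
have not_edge (S : pred 'I_n.*2) k : F1 = hull V S -> F2 = hull V S -> S k ->
    k = ordS i \/ k = ordS (ordS i).
  move=> E1 E2 Sk; have : hull V S (V k) by exact: hull_gen.
  move: F12; rewrite E1 E2 setIid => -> /(hull_vertex n_ge3 AV) /pred2P.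
  by [].
case: (candidates F1 F1_face in1 in1') => E1;
  case: (candidates F2 F2_face in2 in2') => E2; [exfalso|by left|by right|exfalso].
- case: (not_edge _ i E1 E2); first by rewrite /triple /= eqxx.
  + by move/esym/(@iter_ordS_fixed _ 1 i); lia.
  + by move/esym/(@iter_ordS_fixed _ 2 i); lia.
- case: (not_edge _ (iter 3 (@ordS _) i) E1 E2).
  + by rewrite /triple /= eqxx !orbT.
  + by move/ordS_inj/(@iter_ordS_fixed _ 2 i); lia.
  + by move/ordS_inj/ordS_inj/(@iter_ordS_fixed _ 1 i); lia.
Qed.

(** * Outward normals and dihedral angles *)

Lemma cos_sin_pi_div {R : realType} {n : nat} : (3 <= n)%N ->
  [/\ 0 < cos (pi / n%:R : R), cos (pi / n%:R : R) < 1 & 0 < sin (pi / n%:R : R)].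
Proof.
move=> n_ge3; have pi0 := pi_gt0 R.
have n3 : 3 <= n%:R :> R by rewrite ler_nat.
have t_gt0 : 0 < pi / n%:R :> R by rewrite divr_gt0 //; lra.
have t_lt : pi / n%:R < pi / 2 :> R.
  by rewrite ltr_pM2l // ltf_pV2 ?posrE; lra.
have S_gt0 : 0 < sin (pi / n%:R : R) by apply: sin_gt0_pi; lra.
have C_gt0 : 0 < cos (pi / n%:R : R) by apply: cos_gt0_pihalf; lra.
by split=> //; have := cos2Dsin2 (pi / n%:R : R); nra.
Qed.

Lemma frame_cosh {R : realType} {n : nat} {V u v : 'I_n.*2 -> 'rV[R]_4}
    {w q : 'rV[R]_4} {r h : R} (F : antiprism_frame V u v w q r h) k :
  mink (V k) (V (ordS k)) =
    - (1 + 2 * h ^+ 2 + r ^+ 2 * (1 - cos (pi / n%:R))) /\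
  mink (V k) (V (ordS (ordS k))) = - (1 + 2 * r ^+ 2 * sin (pi / n%:R) ^+ 2).
Proof.
have Vu l : mink (V l) (u k) = r * mink (u k) (u l).
  rewrite (mink_frame_vertex F).
  have [_ uw _] := frame_orth F k.
  by have [uq _ _] := frame_orth_q F k; rewrite uw uq; ring.
have Vw l : mink (V l) w = (-1) ^+ l * h.
  rewrite (mink_frame_vertex F) (minkC w (u l)).
  have [_ uw _] := frame_orth F l.
  have [_ _ wq] := frame_orth_q F l.
  have [_ _ ww] := frame_unit F l.
  by rewrite uw ww wq; ring.
have Vq l : mink (V l) q = - (1 + r ^+ 2 + h ^+ 2).
  rewrite (mink_frame_vertex F) (minkC q (u l)) (minkC q w).
  have [uq _ wq] := frame_orth_q F l.
  by rewrite uq wq (frame_q F); ring.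
have [uu vv _] := frame_unit F k.
have [uv _ _] := frame_orth F k.
have s2 : (-1) ^+ k * (-1) ^+ k = 1 :> R by rewrite -expr2 sqrr_sign.
have CS := cos2Dsin2 (pi / n%:R : R).
split; rewrite (mink_frame_vertex F) Vu Vw Vq.
  rewrite (frame_uS F) !minkL uu uv sign_ordS.
  transitivity (r ^+ 2 * cos (pi / n%:R) - (-1) ^+ k * (-1) ^+ k * h ^+ 2
    - (1 + r ^+ 2 + h ^+ 2)); first by ring.
  rewrite s2; ring.
rewrite !(frame_uS F) (frame_vS F) !minkL uu uv.
rewrite !sign_ordS opprK.
transitivity (r ^+ 2 * (cos (pi / n%:R) ^+ 2 - sin (pi / n%:R) ^+ 2)
    + (-1) ^+ k * (-1) ^+ k * h ^+ 2 - (1 + r ^+ 2 + h ^+ 2)); first by ring.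
rewrite s2 (_ : cos (pi / n%:R) ^+ 2 = 1 - sin (pi / n%:R) ^+ 2); last by lra.
ring.
Qed.

(** Scale the normal of a triangle to have radial component 1 at the middle
    vertex; this is its Minkowski square times [4 h^2 (1 + r^2 + h^2)]. *)
Definition triangle_sqnorm {R : realType} (C r h : R) : R :=
  4 * h ^+ 2 * (1 + r ^+ 2 + h ^+ 2)
    + r ^+ 2 * (1 - C) ^+ 2 * (1 + r ^+ 2 + h ^+ 2)
    - r ^+ 2 * (1 + C) ^+ 2 * h ^+ 2.

(** Let [s = (-1)^(i + 1)] and let [alpha], [beta], [gamma], [delta] be the
    coordinates of the normal in the frame at the middle vertex.  Vanishing at
    the outer vertices of the triangle, which are mirror images of each other,
    gives [beta = 0].  The remaining equations
    [r alpha + s h gamma + delta = 0] and [r C alpha - s h gamma + delta = 0]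
    determine [gamma] and [delta], and the inequality at the vertex after the
    triangle says that [alpha >= 0]. *)
Lemma triangle_normal {R : realType} {n : nat} {V u v : 'I_n.*2 -> 'rV[R]_4}
    {w q nu : 'rV[R]_4} {r h : R} (C := cos (pi / n%:R) : R) (i : 'I_n.*2) :
    (3 <= n)%N -> antiprism_frame V u v w q r h ->
    (forall k, H3 (V k)) ->
    outward_normal (hull V predT) (hull V (triple i)) nu ->
  [/\ mink nu (v (ordS i)) = 0, 0 <= mink nu (u (ordS i)),
    mink nu q = - (r * (1 + C) / 2) * mink nu (u (ordS i)),
    (-1) ^+ ordS i * h * mink nu w = - (r * (1 - C) / 2) * mink nu (u (ordS i))
  & mink nu (u (ordS i)) ^+ 2 * triangle_sqnorm C r h
      = 4 * h ^+ 2 * (1 + r ^+ 2 + h ^+ 2)].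
Proof.
move=> n_ge3 F V_H3 /(outward_normal_hull V_H3) [nu1 le0 eq0].
have [C_gt0 C_lt1 S_gt0] := @cos_sin_pi_div R n n_ge3.
have CS := cos2Dsin2 (pi / n%:R : R).
rewrite /C {C}; set C := cos _ in C_gt0 C_lt1 CS *; set S := sin _ in S_gt0 CS *.
have r_gt0 := frame_r F.
have h_neq0 := frame_h F.
have e0 : mink (V i) nu = 0 by apply: eq0; rewrite /triple /= eqxx.
have e1 : mink (V (ordS i)) nu = 0 by apply: eq0; rewrite /triple /= eqxx orbT.
have e2 : mink (V (ordS (ordS i))) nu = 0.
  by apply: eq0; rewrite /triple /= eqxx !orbT.
have e3 := le0 (ordS (ordS (ordS i))).
have nuS k : mink nu (u (ordS k)) = C * mink nu (u k) + S * mink nu (v k) /\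
    mink nu (v (ordS k)) = - S * mink nu (u k) + C * mink nu (v k).
  by rewrite (frame_uS F) (frame_vS F) !minkL.
have sgn : ((-1) ^+ i) ^+ 2 = 1 :> R by exact: sqrr_sign.
rewrite (mink_frame F (ordS i)) in nu1.
move: e0 e1 e2 e3; rewrite !(mink_frame_vertex F).
have [u3 v3] := nuS (ordS (ordS i)); have [u2 v2] := nuS (ordS i).
have [u1 v1] := nuS i.
have -> : mink nu (u i) =
    C * mink nu (u (ordS i)) - S * mink nu (v (ordS i)).
  by rewrite u1 v1 -[LHS]mul1r -CS; ring.
rewrite u3 u2 v2 !sign_ordS !opprK.
move: (mink nu (u (ordS i))) (mink nu (v (ordS i))) (mink nu w) (mink nu q)
  ((-1) ^+ i : R) nu1 sgn => a b c d s nu1 sgn e0 e1 e2 e3.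
have b0 : b = 0.
  have /eqP : r * S * b = 0 by lra.
  by rewrite !mulf_eq0 (gt_eqF r_gt0) (gt_eqF S_gt0) => /eqP.
have dE : d = - (r * (1 + C) / 2) * a by rewrite b0 in e2; lra.
have cE : - s * h * c = - (r * (1 - C) / 2) * a by rewrite b0 in e2; lra.
split=> //.
- have : 0 <= (2 * r * S ^+ 2) * a.
    rewrite b0 in e3; have : r * a = r * a * (C ^+ 2 + S ^+ 2) by rewrite CS mulr1.
    lra.
  by rewrite pmulr_rge0 // !mulr_gt0.
- have Q_neq0 : 1 + r ^+ 2 + h ^+ 2 != 0.
    by apply: lt0r_neq0; have := sqr_ge0 r; have := sqr_ge0 h; lra.
  have c2 : h ^+ 2 * c ^+ 2 = (r * (1 - C) / 2) ^+ 2 * a ^+ 2.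
    transitivity ((- s * h * c) ^+ 2); last by rewrite cE; ring.
    by rewrite -[LHS]mul1r -sgn; ring.
  transitivity (4 * h ^+ 2 * (1 + r ^+ 2 + h ^+ 2) * a ^+ 2
      + 4 * (1 + r ^+ 2 + h ^+ 2) * (h ^+ 2 * c ^+ 2) - 4 * h ^+ 2 * d ^+ 2).
    by rewrite c2 dE /triangle_sqnorm; field.
  transitivity (4 * h ^+ 2 * (1 + r ^+ 2 + h ^+ 2)
    * (a * a + b * b + c * c - d * d / (1 + r ^+ 2 + h ^+ 2))).
    by rewrite b0; field.
  by rewrite nu1 mulr1.
Qed.

(** Three consecutive vertices of the n-gon lie on a circle about the axis and
    are not aligned, so the normal has no component along [u] and [v]; vanishing
    on the n-gon and the inequality at the next vertex of the other n-gon
    determine the rest. *)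
Lemma ngon_normal {R : realType} {n : nat} {V u v : 'I_n.*2 -> 'rV[R]_4}
    {w q nu : 'rV[R]_4} {r h : R} (i : 'I_n.*2) :
    (3 <= n)%N -> antiprism_frame V u v w q r h ->
    (forall k, H3 (V k)) ->
    outward_normal (hull V predT) (hull V (parity_class (odd i))) nu ->
  [/\ mink nu (u (ordS i)) = 0, mink nu (v (ordS i)) = 0,
    mink nu q = (-1) ^+ ordS i * h * mink nu w, mink nu q <= 0
  & mink nu q ^+ 2 * (1 + r ^+ 2) = h ^+ 2 * (1 + r ^+ 2 + h ^+ 2)].
Proof.
move=> n_ge3 F V_H3 /(outward_normal_hull V_H3) [nu1 le0 eq0].
have [C_gt0 C_lt1 S_gt0] := @cos_sin_pi_div R n n_ge3.
have CS := cos2Dsin2 (pi / n%:R : R).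
set C := cos _ in C_gt0 C_lt1 CS; set S := sin _ in S_gt0 CS.
have r_gt0 := frame_r F.
have e0 : mink (V i) nu = 0 by apply: eq0; rewrite /parity_class /= eqxx.
have e1 := le0 (ordS i).
have e2 : mink (V (ordS (ordS i))) nu = 0.
  by apply: eq0; apply/eqP; rewrite !odd_ordS negbK.
have e4 : mink (V (ordS (ordS (ordS (ordS i))))) nu = 0.
  by apply: eq0; apply/eqP; rewrite !odd_ordS !negbK.
have nuS k : mink nu (u (ordS k)) = C * mink nu (u k) + S * mink nu (v k) /\
    mink nu (v (ordS k)) = - S * mink nu (u k) + C * mink nu (v k).
  by rewrite (frame_uS F) (frame_vS F) !minkL.
have sgn : ((-1) ^+ i) ^+ 2 = 1 :> R by exact: sqrr_sign.
rewrite (mink_frame F i) in nu1.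
move: e0 e1 e2 e4; rewrite !(mink_frame_vertex F).
have [u4 _] := nuS (ordS (ordS (ordS i))).
have [u3 v3] := nuS (ordS (ordS i)); have [u2 v2] := nuS (ordS i).
have [u1 v1] := nuS i.
rewrite u4 u3 v3 u2 v2 u1 v1 !sign_ordS !opprK.
move: (mink nu (u i)) (mink nu (v i)) (mink nu w) (mink nu q)
  ((-1) ^+ i : R) nu1 sgn => a b c d s nu1 sgn e0 e1 e2 e4.
have C2 : C ^+ 2 = 1 - S ^+ 2 by lra.
(* Elimination of [b] from the conditions at the vertices [i], [i + 2] and
   [i + 4]: the first two give [C * b = S * a], the third then [a = 0]. *)
have bE : C * b = S * a.
  apply: (mulfI (lt0r_neq0 (mulr_gt0 r_gt0 S_gt0))).
  have : r * a * (C ^+ 2 + S ^+ 2) = r * a by rewrite CS mulr1.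
  lra.
have a0 : a = 0.
  have : r * (4 * S ^+ 2) * a = 0.
    have : r * ((C ^+ 2 - S ^+ 2) ^+ 2 * a - 4 * C ^+ 2 * S ^+ 2 * a
       + 4 * (C ^+ 2 - S ^+ 2) * S * (C * b)) = r * a by lra.
    rewrite bE C2; lra.
  by move/eqP; rewrite mulf_eq0 gt_eqF ?mulr_gt0 // => /eqP.
have b0 : b = 0.
  by move/eqP: bE; rewrite a0 mulr0 mulf_eq0 (gt_eqF C_gt0) => /eqP.
have Q_neq0 : 1 + r ^+ 2 + h ^+ 2 != 0.
  by apply: lt0r_neq0; have := sqr_ge0 r; have := sqr_ge0 h; lra.
have dE : d = - s * h * c by rewrite a0 in e0; lra.
rewrite a0 b0; split=> //; try ring.
  by rewrite a0 b0 in e1; lra.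
have d2 : d ^+ 2 = h ^+ 2 * c ^+ 2.
  by rewrite dE -[RHS]mul1r -sgn; ring.
transitivity ((1 + r ^+ 2 + h ^+ 2) * (h ^+ 2 * c ^+ 2) - h ^+ 2 * d ^+ 2).
  by rewrite -d2; ring.
transitivity (h ^+ 2 * (1 + r ^+ 2 + h ^+ 2)
  * (a * a + b * b + c * c - d * d / (1 + r ^+ 2 + h ^+ 2))).
  by rewrite a0 b0; field.
by rewrite nu1 mulr1.
Qed.

(** Both normals are tangent to the hyperboloid at [p], so the squares of their
    sum and difference are nonnegative.  This places their product in the
    interval [-1, 1], on which [acos] inverts [cos]. *)
Lemma cos_dihedral {R : realType} {p nu1 nu2 : 'rV[R]_4} :
    H3 p -> mink p nu1 = 0 -> mink p nu2 = 0 ->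
    mink nu1 nu1 = 1 -> mink nu2 nu2 = 1 ->
  cos (pi - acos (mink nu1 nu2)) = - mink nu1 nu2.
Proof.
move=> pH3 p1 p2 n11 n22.
have orth (x : 'rV[R]_4) : mink p x = 0 -> 0 <= mink x x.
  by rewrite minkC; apply: mink_orth_ge0.
have := orth (nu1 + nu2); have := orth (nu1 - nu2).
rewrite !minkL p1 p2 n11 n22 (minkC nu2 nu1) => /(_ ltac:(lra)) lo /(_ ltac:(lra)) hi.
rewrite cosB cospi sinpi acosK; first by ring.
by rewrite in_itv /=; apply/andP; split; lra.
Qed.

Lemma triangle_sqnorm_cosh {R : realType} (C r h : R) :
  2 * (1 + 2 * h ^+ 2 + r ^+ 2 * (1 - C)) ^+ 2
    - 1 - (1 + 2 * r ^+ 2 * (1 - C ^+ 2)) = 2 * triangle_sqnorm C r h.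
Proof. by rewrite /triangle_sqnorm; ring. Qed.

(** In the frame at [i + 1], the middle vertex of the triangle, the normal of the
    n-gon has only components along [w] and [q].  The product of the normals is
    then [1 + cosh a - 2 cosh c C], which carries the sign, times a nonnegative
    factor [X]; the square of [X] identifies it with the quotient of square
    roots. *)
Lemma antiprism_cos_A {R : realType} {n : nat} {V u v : 'I_n.*2 -> 'rV[R]_4}
    {w q nu1 nu2 : 'rV[R]_4} {r h : R} (ca cc : R) (C := cos (pi / n%:R) : R)
    (i : 'I_n.*2) :
    (3 <= n)%N -> antiprism_frame V u v w q r h -> (forall k, H3 (V k)) ->
    ca = 1 + 2 * r ^+ 2 * (1 - C ^+ 2) ->
    cc = 1 + 2 * h ^+ 2 + r ^+ 2 * (1 - C) ->
    outward_normal (hull V predT) (hull V (parity_class (odd i))) nu1 ->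
    outward_normal (hull V predT) (hull V (triple i)) nu2 ->
  - mink nu1 nu2 = - Num.sqrt (ca - 1) * (1 + ca - 2 * cc * C)
      / Num.sqrt (2 * (1 + ca - 2 * cc ^+ 2) * (2 * C ^+ 2 - 1 - ca)).
Proof.
move=> n_ge3 F V_H3 caE ccE N1 N2.
have [u1 v1 d1 d1_le0 d1_sqr] := ngon_normal i n_ge3 F V_H3 N1.
have [v2 u2_ge0 d2 c2 disc] := triangle_normal i n_ge3 F V_H3 N2.
have [C_gt0 C_lt1 _] := @cos_sin_pi_div R n n_ge3.
rewrite -/C in C_gt0 C_lt1 d2 c2 disc.
have r_gt0 := frame_r F.
have h_neq0 := frame_h F.
have h2_gt0 : 0 < h ^+ 2 by rewrite exprn_even_gt0.
have r2_gt0 : 0 < r ^+ 2 by rewrite exprn_gt0.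
have C2_lt1 : C ^+ 2 < 1 by nra.
rewrite (mink_frame F (ordS i)) u1 v1 v2.
have sgn : ((-1) ^+ ordS i) ^+ 2 = 1 :> R by exact: sqrr_sign.
move: d1 d1_le0 d1_sqr u2_ge0 d2 c2 disc.
move: ((-1) ^+ ordS i : R) sgn (mink nu1 w) (mink nu1 q) (mink nu2 (u _))
  (mink nu2 w) (mink nu2 q) => s sgn c1 d1 a c2 d2 d1E d1_le0 d1_sqr a_ge0 d2E c2E.
set Q := 1 + r ^+ 2 + h ^+ 2 in d1_sqr *.
set K := triangle_sqnorm C r h => aK.
have Q_gt0 : 0 < Q by rewrite /Q; lra.
have K_gt0 : 0 < K.
  have aK_gt0 : 0 < a ^+ 2 * K by rewrite aK; do 2 apply: mulr_gt0 => //.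
  have a_neq0 : a != 0.
    by apply: contraTneq aK_gt0 => ->; rewrite expr0n /= mul0r ltxx.
  by move: aK_gt0; rewrite pmulr_rgt0 // exprn_even_gt0.
have [h2_neq0 Q_neq0] := (lt0r_neq0 h2_gt0, lt0r_neq0 Q_gt0).
(* The factor of [1 + ca - 2 * cc * C] in the product of the normals. *)
pose X := - d1 * a * r / (4 * h ^+ 2 * Q).
have -> : 2 * (1 + ca - 2 * cc ^+ 2) * (2 * C ^+ 2 - 1 - ca) =
    8 * K * (1 - C ^+ 2) * (1 + r ^+ 2).
  have -> : 1 + ca - 2 * cc ^+ 2 = - (2 * K).
    by rewrite -triangle_sqnorm_cosh caE ccE; ring.
  rewrite caE; ring.
set Y := 8 * K * _ * _.
have Y_gt0 : 0 < Y by rewrite /Y !mulr_gt0 //; lra.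
have -> : Num.sqrt (ca - 1) = X * Num.sqrt Y.
  have X_ge0 : 0 <= X.
    apply: divr_ge0; last exact: (mulr_ge0 (mulr_ge0 _ (ltW h2_gt0)) (ltW Q_gt0)).
    by rewrite !mulr_ge0 ?oppr_ge0 // ltW.
  rewrite -(ger0_norm X_ge0) -sqrtr_sqr -sqrtrM ?sqr_ge0 //; congr Num.sqrt.
  have -> : X ^+ 2 * Y = (d1 ^+ 2 * (1 + r ^+ 2)) * (a ^+ 2 * K) * r ^+ 2
      * (1 - C ^+ 2) / (2 * h ^+ 4 * Q ^+ 2).
    by rewrite /X /Y; field; rewrite h_neq0 Q_neq0.
  by rewrite d1_sqr aK -/Q caE; field; rewrite h_neq0 Q_neq0.
have sY_neq0 : Num.sqrt Y != 0 by rewrite lt0r_neq0 ?sqrtr_gt0.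
have c1c2 : h ^+ 2 * (c1 * c2) = - (r * (1 - C) / 2) * a * d1.
  transitivity ((s * h * c2) * (s * h * c1)); last by rewrite c2E d1E.
  by rewrite -[LHS]mul1r -sgn; ring.
have -> : c1 * c2 = - (r * (1 - C) / 2) * a * d1 / h ^+ 2.
  by rewrite -c1c2; field.
rewrite d2E /X caE ccE; rewrite /Q in Q_neq0 *; field.
by rewrite sY_neq0 h_neq0 Q_neq0.
Qed.

(** Both triangles have the same coordinates in the frames at their respective
    middle vertices, except that the component along [w] changes sign.  The
    radial directions of the two frames have product [C], so the product of the
    normals is [alpha^2 C - gamma^2 - delta^2 / Q]. *)
Lemma antiprism_cos_C {R : realType} {n : nat} {V u v : 'I_n.*2 -> 'rV[R]_4}
    {w q nu1 nu2 : 'rV[R]_4} {r h : R} (ca cc : R) (C := cos (pi / n%:R) : R)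
    (i : 'I_n.*2) :
    (3 <= n)%N -> antiprism_frame V u v w q r h -> (forall k, H3 (V k)) ->
    ca = 1 + 2 * r ^+ 2 * (1 - C ^+ 2) ->
    cc = 1 + 2 * h ^+ 2 + r ^+ 2 * (1 - C) ->
    outward_normal (hull V predT) (hull V (triple i)) nu1 ->
    outward_normal (hull V predT) (hull V (triple (ordS i))) nu2 ->
  - mink nu1 nu2 = (cc - ca * cc + 2 * (cc ^+ 2 - 1) * C)
      / (1 + ca - 2 * cc ^+ 2).
Proof.
move=> n_ge3 F V_H3 caE ccE N1 N2.
have [v1 u1_ge0 d1 c1 disc1] := triangle_normal i n_ge3 F V_H3 N1.
have [v2 u2_ge0 d2 c2 disc2] := triangle_normal (ordS i) n_ge3 F V_H3 N2.
rewrite -/C in d1 c1 disc1 d2 c2 disc2.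
have h_neq0 := frame_h F.
have h2_gt0 : 0 < h ^+ 2 by rewrite exprn_even_gt0.
have Q_gt0 : 0 < 1 + r ^+ 2 + h ^+ 2 by have := sqr_ge0 r; lra.
have Q_neq0 := lt0r_neq0 Q_gt0.
have K_neq0 : triangle_sqnorm C r h != 0.
  apply/eqP => K0; move: disc1; rewrite K0 mulr0 => /eqP.
  by rewrite lt_eqF //; do 2 apply: mulr_gt0 => //.
have a12 : mink nu1 (u (ordS i)) = mink nu2 (u (ordS (ordS i))).
  apply/eqP; rewrite -(@eqrXn2 _ 2) //; apply/eqP.
  by apply: (mulIf K_neq0); rewrite disc1 disc2.
(* Rotating the frame at [i + 2] back by one step; the tangential component at
   [i + 2] vanishes. *)
have u2 : mink nu2 (u (ordS i)) = C * mink nu2 (u (ordS (ordS i))).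
  have CS := cos2Dsin2 (pi / n%:R : R); rewrite -/C in CS.
  move: v2; rewrite (frame_uS F (ordS i)).
  rewrite (frame_vS F (ordS i)) !minkL -/C.
  move: CS; set S := sin _ => CS v2; rewrite -[LHS]mul1r -[in LHS]CS.
  transitivity (C ^+ 2 * mink nu2 (u (ordS i)) + S * (S * mink nu2 (u (ordS i)))).
    by ring.
  have -> : S * mink nu2 (u (ordS i)) = C * mink nu2 (v (ordS i)) by lra.
  ring.
rewrite (mink_frame F (ordS i)) v1 u2 a12.
rewrite sign_ordS in c2.
rewrite a12 in d1 c1.
have sgn : ((-1) ^+ ordS i) ^+ 2 = 1 :> R by exact: sqrr_sign.
move: d1 c1 d2 c2 disc2.
move: ((-1) ^+ ordS i : R) sgn (mink nu1 w) (mink nu1 q) (mink nu2 (u _))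
  (mink nu2 w) (mink nu2 q) => s sgn c1 d1 a c2 d2 d1E c1E d2E c2E aK.
have c1c2 : h ^+ 2 * (c1 * c2) = - (r * (1 - C) / 2) ^+ 2 * a ^+ 2.
  transitivity (- (s * h * c1) * (- s * h * c2)); last by rewrite c1E c2E; ring.
  by rewrite -[LHS]mul1r -sgn; ring.
have -> : c1 * c2 = - (r * (1 - C) / 2) ^+ 2 * a ^+ 2 / h ^+ 2.
  by rewrite -c1c2; field.
have -> : 1 + ca - 2 * cc ^+ 2 = - (2 * triangle_sqnorm C r h).
  by rewrite -triangle_sqnorm_cosh caE ccE; ring.
rewrite d1E d2E.
transitivity (- a ^+ 2 * (C - r ^+ 2 * (1 - C) ^+ 2 / (4 * h ^+ 2)
   - r ^+ 2 * (1 + C) ^+ 2 / (4 * (1 + r ^+ 2 + h ^+ 2)))).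
  by field; rewrite h_neq0 Q_neq0.
have -> : a ^+ 2 = 4 * h ^+ 2 * (1 + r ^+ 2 + h ^+ 2) / triangle_sqnorm C r h.
  by rewrite -aK; field.
rewrite caE ccE; field.
by rewrite K_neq0 h_neq0 Q_neq0.
Qed.

Theorem theorem3p3 (R : realType) (n : nat) (V : 'I_n.*2 -> 'rV[R]_4)
    (a c A C : R) (i j : 'I_n.*2)
    (n_ge3 : (3 <= n)%N) (V_antiprism : antiprism V)
    (a_length : forall k, hdist (V k) (V (ordS (ordS k))) = a)
    (c_length : forall k, hdist (V k) (V (ordS k)) = c)
    (A_angle : dihedral_angle (hull V predT)
                 (hull V (pred2 i (ordS (ordS i)))) A)
    (C_angle : dihedral_angle (hull V predT) (hull V (pred2 j (ordS j))) C) :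
  cos A = - Num.sqrt (cosh a - 1)
            * (1 + cosh a - 2 * cosh c * cos (pi / n%:R))
          / Num.sqrt (2 * (1 + cosh a - 2 * cosh c ^+ 2)
                        * (cos (2 * pi / n%:R) - cosh a))
  /\
  cos C = (cosh c - cosh a * cosh c
             + 2 * (cosh c ^+ 2 - 1) * cos (pi / n%:R))
          / (1 + cosh a - 2 * cosh c ^+ 2).
Proof.
have V_H3 := antiprism_compact V_antiprism.
have [u [v [w [q [r [h F]]]]]] := antiprism_has_frame n_ge3 V_antiprism.
have sin2 : sin (pi / n%:R) ^+ 2 = 1 - cos (pi / n%:R) ^+ 2 :> R.
  by have := cos2Dsin2 (pi / n%:R : R); lra.
have [mc ma] := frame_cosh F i.
have caE : cosh a = 1 + 2 * r ^+ 2 * (1 - cos (pi / n%:R) ^+ 2).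
  by rewrite -(a_length i) cosh_hdist // ma sin2; ring.
have ccE : cosh c = 1 + 2 * h ^+ 2 + r ^+ 2 * (1 - cos (pi / n%:R)).
  by rewrite -(c_length i) cosh_hdist // mc; ring.
have angleE (E : pred 'I_n.*2) k F1 F2 nu1 nu2 :
    (F1 `&` F2)%classic = hull V E -> E k ->
    outward_normal (hull V predT) F1 nu1 ->
    outward_normal (hull V predT) F2 nu2 ->
    cos (pi - acos (mink nu1 nu2)) = - mink nu1 nu2.
  move=> F12 Ek [n11 _ F1E] [n22 _ F2E].
  have [] : (F1 `&` F2)%classic (V k) by rewrite F12; exact: hull_gen.
  rewrite F1E F2E => -[_ [_ k1]] [_ [_ k2]].
  exact: (cos_dihedral (V_H3 k)).
split.
- case: A_angle => F1 [F2 [nu1 [nu2 [[f1 f2] F12 N1 N2 ->]]]].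
  rewrite (angleE _ i _ _ _ _ F12 _ N1 N2) /= ?eqxx //.
  have -> : cos (2 * pi / n%:R) = 2 * cos (pi / n%:R) ^+ 2 - 1 :> R.
    have -> : 2 * pi / n%:R = (pi / n%:R) *+ 2 :> R by rewrite mulr2n; ring.
    by rewrite cos_mulr2n mulr_natl.
  case: (faces_at_edge_a n_ge3 V_antiprism f1 f2 F12) => -[E1 E2].
    rewrite E1 in N1; rewrite E2 in N2.
    exact: (antiprism_cos_A _ _ i n_ge3 F V_H3 caE ccE N1 N2).
  rewrite E1 in N2; rewrite E2 in N1; rewrite minkC.
  exact: (antiprism_cos_A _ _ i n_ge3 F V_H3 caE ccE N2 N1).
- case: C_angle => F1 [F2 [nu1 [nu2 [[f1 f2] F12 N1 N2 ->]]]].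
  rewrite (angleE _ j _ _ _ _ F12 _ N1 N2) /= ?eqxx //.
  have [k kj] := faces_at_edge_c n_ge3 V_antiprism f1 f2 F12.
  move=> [[E1 E2]|[E1 E2]]; rewrite -kj in E2.
    rewrite E1 in N1; rewrite E2 in N2.
    exact: (antiprism_cos_C _ _ k n_ge3 F V_H3 caE ccE N1 N2).
  rewrite E1 in N2; rewrite E2 in N1; rewrite minkC.
  exact: (antiprism_cos_C _ _ k n_ge3 F V_H3 caE ccE N2 N1).
Qed.
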